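(* Let $R$ be a commutative ring with unity, let $G$ be a group, and let $\sigma,\tau$ be $R$-algebra endomorphisms of $RG$ which are $R$-linear extensions of group endomorphisms of $G$. Let $\{C_i\}_{i\in I}$ be the collection of all $(\sigma,\tau)$-conjugacy classes of $G$ which are of finite size, with respective representatives $\{x_i\}_{i\in I}$ ($x_i\in C_i$). Let $J\subseteq I$ be such that $|C_j|=1$ for all $j\in J$ and $|C_i|\ge 2$ for all $i\in I\setminus J$. Further, let $\{C_{i'}\}_{i'\in I'}$ be the collection of all those $(\sigma,\tau)$-conjugacy classes of $G$ which are of infinite size. Then the set $$\mathcal{B}_0=\left\{D_g \;\middle|\; g\in\left(\bigcup_{i\in I\setminus J}(C_i\setminus\{x_i\})\right)\cup\left(\bigcup_{i'\in I'}C_{i'}\right)\right\}$$ forms an $R$-basis of $\mathrm{Inn}_{(\sigma,\tau)}(RG)$.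
   Context: For $x\in G$, the $(\sigma,\tau)$-conjugacy class of $x$ in $G$ is $\{\sigma(g)x\tau(g)^{-1}\mid g\in G\}$; these classes partition $G$. For $\beta\in RG$, $D_\beta: RG\to RG$ denotes the inner $(\sigma,\tau)$-derivation $D_\beta(\alpha)=\beta\tau(\alpha)-\sigma(\alpha)\beta$. $\mathrm{Inn}_{(\sigma,\tau)}(RG)=\{D_\beta\mid\beta\in RG\}$, an $R$-module under pointwise operations. *)

(* Defs.v *)
From HB Require Import structures.
From mathcomp Require Import all_boot all_order all_algebra.
From mathcomp Require Import finmap.
From mathcomp Require Import boolp classical_sets functions cardinality.
From mathcomp Require Import xfinmap monalg.

Set Implicit Arguments.
Unset Strict Implicit.
Unset Printing Implicit Defensive.

Import GRing.Theory.
Local Open Scope classical_set_scope.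
Local Open Scope ring_scope.

(* The group ring RG, carried by the finitely supported functions G -> R.
   The ring and module structures that monalg puts on {malg R[G]} need
   1 != 0 in R and a monoid with no nontrivial unit, so they are rebuilt here
   under a new name, for an arbitrary group and an arbitrary ring, the zero
   ring included. *)
Definition grpring (R : pzRingType) (G : groupType) : Type := {malg R[G]}.

Section GroupRing.
Variables (R : pzRingType) (G : groupType).
Local Notation RG := (grpring R G).
Implicit Types (a b : RG) (c : R) (g h : G).

HB.instance Definition _ := GRing.Zmodule.on RG.

Definition grpring_elt (g : G) : RG := << 1 *g g >>.

Definition grpring_scale c a : RG := [malg g in msupp a => c * a@_g].

Definition grpring_mul a b : RG :=
  \sum_(g <- msupp a) \sum_(h <- msupp b) << a@_g * b@_h *g (g * h)%g >>.

Lemma grpring_scaleE c a g : (grpring_scale c a)@_g = c * a@_g.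
Proof. by rewrite mcoeffE; case: msuppP; rewrite ?mulr0. Qed.

Fact grpring_scaleA c1 c2 a :
  grpring_scale c1 (grpring_scale c2 a) = grpring_scale (c1 * c2) a.
Proof. by apply/malgP => g; rewrite !grpring_scaleE mulrA. Qed.

Fact grpring_scale1 : left_id 1 grpring_scale.
Proof. by move=> a; apply/malgP => g; rewrite grpring_scaleE mul1r. Qed.

Fact grpring_scaleDr : right_distributive grpring_scale +%R.
Proof.
move=> c a b; apply/malgP => g.
by rewrite !(mcoeffD, grpring_scaleE) mulrDr.
Qed.

Fact grpring_scaleDl a : {morph grpring_scale^~ a : c1 c2 / c1 + c2}.
Proof.
move=> c1 c2; apply/malgP => g.
by rewrite !(mcoeffD, grpring_scaleE) mulrDl.
Qed.

HB.instance Definition _ := GRing.Zmodule_isLmodule.Build R RG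
  grpring_scaleA grpring_scale1 grpring_scaleDr grpring_scaleDl.

Lemma grpring_mulEw (A B : {fset G}) a b :
  (msupp a `<=` A)%fset -> (msupp b `<=` B)%fset ->
  grpring_mul a b =
    \sum_(g <- A) \sum_(h <- B) << a@_g * b@_h *g (g * h)%g >>.
Proof.
move=> leA leB; rewrite /grpring_mul (big_fset_incl _ leA) /=.
  apply/eq_bigr => g _; apply/big_fset_incl => // h _ /mcoeff_outdom ->.
  by rewrite mulr0 monalgU0.
move=> g _ /mcoeff_outdom ag0.
by rewrite big1 // => h _; rewrite ag0 mul0r monalgU0.
Qed.

Fact grpring_mulDl : left_distributive grpring_mul +%R.
Proof.
move=> a1 a2 b.
rewrite (grpring_mulEw (msuppD_le a1 a2) (fsubset_refl _)).
rewrite (grpring_mulEw (fsubsetUl _ (msupp a2)) (fsubset_refl _)).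
rewrite (grpring_mulEw (fsubsetUr (msupp a1) _) (fsubset_refl _)).
rewrite -big_split; apply: eq_bigr => g _.
rewrite -big_split; apply: eq_bigr => h _.
by rewrite mcoeffD mulrDl monalgUD.
Qed.

Fact grpring_mulDr : right_distributive grpring_mul +%R.
Proof.
move=> a b1 b2.
rewrite (grpring_mulEw (fsubset_refl _) (msuppD_le b1 b2)).
rewrite (grpring_mulEw (fsubset_refl _) (fsubsetUl _ (msupp b2))).
rewrite (grpring_mulEw (fsubset_refl _) (fsubsetUr (msupp b1) _)).
rewrite -big_split; apply: eq_bigr => g _.
rewrite -big_split; apply: eq_bigr => h _.
by rewrite mcoeffD mulrDr monalgUD.
Qed.

Fact grpring_mul0l : left_zero 0 grpring_mul.
Proof. by move=> a; rewrite /grpring_mul msupp0 big_seq_fset0. Qed.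

Fact grpring_mul0r : right_zero 0 grpring_mul.
Proof.
move=> a; rewrite /grpring_mul msupp0 big1 // => g _.
by rewrite big_seq_fset0.
Qed.

Lemma grpring_mulUU c1 c2 g h :
  grpring_mul << c1 *g g >> << c2 *g h >> = << c1 * c2 *g (g * h)%g >>.
Proof.
by rewrite (grpring_mulEw msuppU_le msuppU_le) !big_seq_fset1 !mcoeffUU.
Qed.

Lemma grpring_mul_suml (J : Type) (r : seq J) (F : J -> RG) b :
  grpring_mul (\sum_(j <- r) F j) b = \sum_(j <- r) grpring_mul (F j) b.
Proof.
exact: (big_morph (grpring_mul^~ b) (fun _ _ => grpring_mulDl _ _ _)
  (grpring_mul0l _)).
Qed.

Lemma grpring_mul_sumr (J : Type) (r : seq J) (F : J -> RG) a :
  grpring_mul a (\sum_(j <- r) F j) = \sum_(j <- r) grpring_mul a (F j).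
Proof.
exact: (big_morph (grpring_mul a) (fun _ _ => grpring_mulDr _ _ _)
  (grpring_mul0r _)).
Qed.

Fact grpring_mulA : associative grpring_mul.
Proof.
move=> a1 a2 a3; rewrite [a1]monalgE grpring_mul_suml.
rewrite (grpring_mul_suml _ _ a2) grpring_mul_suml.
apply: eq_bigr => g1 _; rewrite [a2]monalgE (grpring_mul_suml _ _ a3).
rewrite !(grpring_mul_sumr _ _ << _ *g g1 >>) grpring_mul_suml.
apply: eq_bigr => g2 _; rewrite [a3]monalgE.
rewrite (grpring_mul_sumr _ _ << _ *g g2 >>) !grpring_mul_sumr.
by apply: eq_bigr => g3 _; rewrite !grpring_mulUU mulrA mulgA.
Qed.

Fact grpring_mul1l : left_id (grpring_elt 1%g) grpring_mul.
Proof.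
move=> a; rewrite [a]monalgE grpring_mul_sumr; apply: eq_bigr => g _.
by rewrite grpring_mulUU mul1r mul1g.
Qed.

Fact grpring_mul1r : right_id (grpring_elt 1%g) grpring_mul.
Proof.
move=> a; rewrite [a]monalgE grpring_mul_suml; apply: eq_bigr => g _.
by rewrite grpring_mulUU mulr1 mulg1.
Qed.

HB.instance Definition _ := GRing.Zmodule_isPzRing.Build RG
  grpring_mulA grpring_mul1l grpring_mul1r grpring_mulDl grpring_mulDr.

(* RG is an R-algebra, but lalgType and {lrmorphism _ -> _} require 1 != 0;
   an R-algebra endomorphism of RG is thus a scalable {rmorphism RG -> RG}. *)
Lemma grpring_scalerAl c a b : c *: (a * b) = (c *: a) * b.
Proof.
have scaleE c' d : c' *: d = grpring_mul << c' *g 1%g >> d.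
  rewrite [d in RHS]monalgE grpring_mul_sumr [LHS]monalgE.
  rewrite (@big_fset_incl _ _ _ _ (msupp (c' *: d)) (msupp d)) => [||g _].
  - by apply: eq_bigr => g _; rewrite grpring_mulUU grpring_scaleE mul1g.
  - apply/fsubsetP => g; rewrite -!mcoeff_neq0 grpring_scaleE.
    by apply: contraNneq => ->; rewrite mulr0.
  - by move=> /mcoeff_outdom ->; rewrite monalgU0.
by rewrite !scaleE; exact: grpring_mulA.
Qed.

End GroupRing.

Lemma grpring_scalerAr (R : comPzRingType) (G : groupType)
  (c : R) (a b : grpring R G) : c *: (a * b) = a * (c *: b).
Proof.
have UZ c1 c2 g : c1 *: (<< c2 *g g >> : grpring R G) = << c1 * c2 *g g >>.
  apply/malgP => h; rewrite grpring_scaleE !mcoeffU.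
  by case: eqP => _; rewrite ?mulr0.
have sumM (J : Type) (r : seq J) (F : J -> grpring R G) d :
    (\sum_(j <- r) F j) * d = \sum_(j <- r) F j * d by exact: mulr_suml.
have Msum (J : Type) (r : seq J) (F : J -> grpring R G) d :
    d * (\sum_(j <- r) F j) = \sum_(j <- r) d * F j by exact: mulr_sumr.
rewrite [a]monalgE !sumM scaler_sumr; apply: eq_bigr => g _.
rewrite [b]monalgE [in RHS]scaler_sumr !Msum scaler_sumr.
apply: eq_bigr => h _; rewrite UZ.
have UU c1 c2 k l : (<< c1 *g k >> : grpring R G) * << c2 *g l >> =
  << c1 * c2 *g (k * l)%g >> by exact: grpring_mulUU.
by rewrite !UU UZ mulrCA.
Qed.

Arguments grpring_elt {R G} g.

Section LinearAlgebra.
Variables (R : pzRingType) (V : lmodType R).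
Implicit Types B M : set V.

Definition lin_span B : set V :=
  [set v | exists (n : nat) (b : 'I_n -> V) (c : 'I_n -> R),
    (forall i, B (b i)) /\ v = \sum_(i < n) c i *: b i].

Definition lin_indep B : Prop :=
  forall (n : nat) (b : 'I_n -> V) (c : 'I_n -> R),
    injective b -> (forall i, B (b i)) ->
    \sum_(i < n) c i *: b i = 0 -> forall i, c i = 0.

Definition is_basis M B : Prop := lin_indep B /\ lin_span B = M.

End LinearAlgebra.

Section Twisted.
Variables (R : comPzRingType) (G : groupType).
Local Notation RG := (grpring R G).

Definition twisted_class (s t : G -> G) (x : G) : set G :=
  range (fun g => s g * x * (t g)^-1)%g.

Definition twisted_classes (s t : G -> G) : set (set G) :=
  range (twisted_class s t).

Definition linear_extension (s : G -> G) (sigma : RG -> RG) : Prop :=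
  scalable sigma /\ forall g : G, sigma (grpring_elt g) = grpring_elt (s g).

Definition inner_der (sigma tau : RG -> RG) (b : RG) : RG -> RG :=
  fun a => b * tau a - sigma a * b.

(* A subset of RG -> RG, with its pointwise R-module structure. *)
Definition Inn (sigma tau : RG -> RG) : set (RG -> RG) :=
  range (inner_der sigma tau).

End Twisted.

(* Main.v *)
Require Import Defs.
From HB Require Import structures.
From mathcomp Require Import all_boot all_order all_algebra.
From mathcomp Require Import boolp classical_sets functions cardinality.
From mathcomp Require Import finmap monalg.

Set Implicit Arguments.
Unset Strict Implicit.
Unset Printing Implicit Defensive.

Import GRing.Theory.
Local Open Scope classical_set_scope.
Local Open Scope card_scope.
Local Open Scope ring_scope.

(** Write D_b for the inner derivation of b. The map b |-> D_b is R-linear, so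
    Inn is spanned by the D_g with g in G, and everything is decided by its
    kernel. Evaluating D_b at a group element h, the coefficient of
    D_b(h) = b t(h) - s(h) b at s(h) k is b_(s(h) k t(h)^-1) - b_k; since an
    inner derivation is determined by its values on G, D_b = 0 exactly when b
    is constant on each twisted conjugacy class ([inner_der_eq0P]).

    As b has finite support, such a b vanishes on every infinite class
    ([class_function_infinite]), so the kernel consists of the combinations of
    the sums of the finite classes. Hence each finite class K gives one
    relation, sum_(g in K) D_g = 0 ([sum_inner_der_class]), which expresses the
    generator at the representative of K through the others: dropping the
    representatives keeps a spanning family (and drops a singleton class
    altogether). Conversely, if the support of b contains no representative
    of a finite class and D_b = 0, then b is zero on the infinite classes, and
    on a finite class it is constant and zero at the representative, so b = 0:
    what remains is independent. *)

(** * Spans *)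

Section LinSpan.
Variables (R : pzRingType) (V : lmodType R) (B : set V).

Lemma lin_span0 : lin_span B 0.
Proof.
by exists 0, (fun=> 0), (fun=> 0); split=> [[]//|]; rewrite big_ord0.
Qed.

Lemma lin_span_gen v : B v -> lin_span B v.
Proof.
by move=> Bv; exists 1, (fun=> v), (fun=> 1); rewrite big_ord1 scale1r.
Qed.

Lemma lin_spanD u v : lin_span B u -> lin_span B v -> lin_span B (u + v).
Proof.
move=> [m [b [c [Bb ->]]]] [n [b' [c' [Bb' ->]]]].
exists (m + n)%N,
  (fun i => match fintype.split i with inl j => b j | inr k => b' k end),
  (fun i => match fintype.split i with inl j => c j | inr k => c' k end).
split=> [i|]; first by case: fintype.split.
rewrite big_split_ord; congr (_ + _); apply: eq_bigr => i _.
  by rewrite (unsplitK (inl i)).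
by rewrite (unsplitK (inr i)).
Qed.

Lemma lin_spanZ a v : lin_span B v -> lin_span B (a *: v).
Proof.
move=> [n [b [c [Bb ->]]]]; exists n, b, (fun i => a * c i); split=> //.
by rewrite scaler_sumr; apply: eq_bigr => i _; rewrite scalerA.
Qed.

Lemma lin_spanN v : lin_span B v -> lin_span B (- v).
Proof. by rewrite -scaleN1r; exact: lin_spanZ. Qed.

Lemma lin_span_sum (T : eqType) (r : seq T) (P : pred T) (F : T -> V) :
  (forall i, i \in r -> P i -> lin_span B (F i)) ->
  lin_span B (\sum_(i <- r | P i) F i).
Proof.
move=> spanF; rewrite big_seq_cond.
apply: (big_ind (lin_span B)) => [||i /andP[]].
- exact: lin_span0.
- exact: lin_spanD.
- exact: spanF.
Qed.

End LinSpan.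

(** * Coefficients in the group ring *)

Section GroupRingCoefficients.
Variables (R : pzRingType) (G : groupType).
Local Notation RG := (grpring R G).
Implicit Types (a b : RG) (c : R) (g h k : G).

Lemma mcoeff_elt g k : (grpring_elt g : RG)@_k = (g == k)%:R.
Proof. by rewrite mcoeffU. Qed.

Lemma grpring_sum_elt a :
  a = \sum_(g <- msupp a) a@_g *: (grpring_elt g : RG).
Proof.
rewrite [LHS]monalgE; apply: eq_bigr => g _; apply/malgP => k.
by rewrite grpring_scaleE mcoeff_elt mcoeffU mulr_natr.
Qed.

Lemma mcoeff_mul_elt a h k : (a * grpring_elt h : RG)@_k = a@_(k * h^-1)%g.
Proof.
have -> : a * grpring_elt h = \sum_(g <- msupp a) << a@_g *g (g * h)%g >>.
  rewrite [a in LHS]monalgE [LHS]grpring_mul_suml; apply: eq_bigr => g _.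
  by rewrite grpring_mulUU mulr1.
rewrite [a in RHS]monalgE !raddf_sum; apply: eq_bigr => g _.
by rewrite /= !mcoeffU (can2_eq (mulgK h) (mulgVK h)).
Qed.

Lemma mcoeff_elt_mul a h k : (grpring_elt h * a : RG)@_k = a@_(h^-1 * k)%g.
Proof.
have -> : grpring_elt h * a = \sum_(g <- msupp a) << a@_g *g (h * g)%g >>.
  rewrite [a in LHS]monalgE [LHS]grpring_mul_sumr; apply: eq_bigr => g _.
  by rewrite grpring_mulUU mul1r.
rewrite [a in RHS]monalgE !raddf_sum; apply: eq_bigr => g _.
by rewrite /= !mcoeffU (can2_eq (mulKg h) (mulVKg h)).
Qed.

End GroupRingCoefficients.

(** * Twisted conjugacy classes *)

Section TwistedClasses.
Variables (G : groupType) (s t : UMagmaMorphism.type G G).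
Implicit Types (g h x y : G) (K : set G).

Lemma twisted_class_refl x : twisted_class s t x x.
Proof. by exists 1%g => //; rewrite !gmulf1 mul1g divg1. Qed.

Lemma twisted_class_act x y g : twisted_class s t x y ->
  twisted_class s t x (s g * y * (t g)^-1)%g.
Proof.
by move=> [h _ <-]; exists (g * h)%g => //; rewrite !gmulfM invgM !mulgA.
Qed.

Lemma twisted_class_sym x y : twisted_class s t x y -> twisted_class s t y x.
Proof.
move=> [g _ <-]; exists (g^-1)%g => //.
by rewrite !gmulfV invgK !mulgA mulVg mul1g mulgVK.
Qed.

Lemma twisted_class_trans x y z :
  twisted_class s t x y -> twisted_class s t y z -> twisted_class s t x z.
Proof. by move=> xy [g _ <-]; exact: twisted_class_act. Qed.

Lemma twisted_class_eq K x :
  twisted_classes s t K -> K x -> K = twisted_class s t x.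
Proof.
move=> [y _ <-] yx; apply/seteqP; split=> z; last exact: twisted_class_trans.
by apply: twisted_class_trans; exact: twisted_class_sym.
Qed.

End TwistedClasses.

(** * Inner derivations and their kernel *)

Section InnerDerivations.
Variables (R : comPzRingType) (G : groupType).
Variables (s t : UMagmaMorphism.type G G).
Local Notation RG := (grpring R G).
Variables (sigma tau : {rmorphism RG -> RG}).
Hypotheses (sigma_ext : linear_extension s sigma).
Hypotheses (tau_ext : linear_extension t tau).
Local Notation D := (inner_der sigma tau).
Implicit Types (a b : RG) (g h : G) (K : set G).

Lemma inner_derD : {morph D : a b / a + b}.
Proof.
move=> a b; apply/funext => u.
by rewrite /D mulrDl mulrDr addrACA -opprD.
Qed.

(** Commutativity of R is what lets a scalar pass through sigma u in the
    term sigma u * (c *: b). *)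
Lemma inner_derZ c b : D (c *: b) = c *: D b.
Proof.
apply/funext => u.
by rewrite /D -grpring_scalerAl -grpring_scalerAr -scalerBr.
Qed.

Lemma inner_der0 : D 0 = 0.
Proof. by rewrite -(scale0r 0) inner_derZ scale0r. Qed.

Lemma inner_der_sum (T : Type) (r : seq T) (P : pred T) (F : T -> RG) :
  D (\sum_(i <- r | P i) F i) = \sum_(i <- r | P i) D (F i).
Proof. exact: (big_morph D inner_derD inner_der0). Qed.

Lemma inner_der_sum_elt b : D b = \sum_(g <- msupp b) b@_g *: D (grpring_elt g).
Proof.
rewrite [b in LHS]grpring_sum_elt inner_der_sum.
by apply: eq_bigr => g _; rewrite inner_derZ.
Qed.

(** For s = t = id these are the central elements of RG, that is the class
    functions of finite support. *)
Definition class_function b := forall g x, b@_(s g * x * (t g)^-1)%g = b@_x.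

(** On a group element h both products in D b h are mere translations of b by
    t h and s h, so their difference compares the coefficients of b at two
    points of one twisted class. Linearity of sigma and tau extends the
    vanishing from G to RG. *)
Lemma inner_der_eq0P b : D b = 0 <-> class_function b.
Proof.
have coefD h k : (D b (grpring_elt h))@_k
    = b@_(k * (t h)^-1)%g - b@_((s h)^-1 * k)%g.
  rewrite /inner_der sigma_ext.2 tau_ext.2 mcoeffB.
  by rewrite mcoeff_mul_elt mcoeff_elt_mul.
split=> [Db0 g x|bC].
  (* The coefficient to read off is the one that puts x in the second term. *)
  have := coefD g (s g * x)%g; rewrite Db0 mcoeff0 mulKg.
  by move=> /esym/eqP; rewrite subr_eq0 => /eqP.
have D0 h : D b (grpring_elt h) = 0.
  apply/malgP => k; rewrite coefD mcoeff0 -(bC h ((s h)^-1 * k)%g) mulVKg.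
  by rewrite subrr.
apply/funext => a; rewrite (grpring_sum_elt a) /inner_der !rmorph_sum.
rewrite mulr_sumr mulr_suml -sumrB big1// => h _.
rewrite sigma_ext.1 tau_ext.1 -grpring_scalerAr -grpring_scalerAl -scalerBr.
by rewrite [X in _ *: X]D0 scaler0.
Qed.

Lemma class_function_const b x y : class_function b ->
  twisted_class s t x y -> b@_y = b@_x.
Proof. by move=> bC [g _ <-]; exact: bC. Qed.

(** A nonzero value at x would be taken on the whole class of x, which would
    then lie in the finite support of b. *)
Lemma class_function_infinite b x : class_function b ->
  infinite_set (twisted_class s t x) -> b@_x = 0.
Proof.
move=> bC; apply: contra_notP => /eqP bx0.
apply: (@finite_subfset _ (msupp b)) => y /(class_function_const bC) byx.
by rewrite /= -mcoeff_neq0 byx.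
Qed.

(** The coefficients of the class sum are the indicator function of K, which is
    constant on classes, so the class sum lies in the kernel of b |-> D b. *)
Lemma sum_inner_der_class K : twisted_classes s t K -> finite_set K ->
  \sum_(g <- fset_set K) D (grpring_elt g) = 0.
Proof.
move=> [x _ <-] finK; rewrite -inner_der_sum; apply/inner_der_eq0P => g y.
have coefK z :
    (\sum_(g <- fset_set (twisted_class s t x)) (grpring_elt g : RG))@_z
    = (z \in fset_set (twisted_class s t x))%:R.
  rewrite raddf_sum /=; case: (boolP (z \in _)) => zK.
    rewrite (big_fsetD1 z)//= mcoeff_elt eqxx big_seq big1 ?addr0// => h.
    by rewrite !inE mcoeff_elt => /andP[/negPf-> _].
  rewrite big_seq big1// => h hK; rewrite mcoeff_elt.
  by case: eqP hK zK => // <- ->.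
rewrite !coefK !in_fset_set//; congr (nat_of_bool _)%:R.
apply/idP/idP; rewrite !in_setE; last exact: twisted_class_act.
move=> xgy; apply: (twisted_class_trans xgy); apply: twisted_class_sym.
by exists g.
Qed.

End InnerDerivations.

(** * The basis *)

Theorem theorem4p13 (R : comPzRingType) (G : groupType)
    (s t : UMagmaMorphism.type G G)
    (sigma tau : {rmorphism grpring R G -> grpring R G})
    (sigma_ext : linear_extension s sigma)
    (tau_ext : linear_extension t tau)
    (I : Type) (C : I -> set G)
    (C_enum : set_bij [set: I]
       [set K | twisted_classes s t K /\ finite_set K] C)
    (x : I -> G) (x_rep : forall i, C i (x i))
    (J : set I)
    (J_card : forall j, J j -> C j #= `I_1)
    (nJ_card : forall i, ~ J i -> `I_2 #<= C i)
    (I' : Type) (C' : I' -> set G)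
    (C'_enum : set_bij [set: I']
       [set K | twisted_classes s t K /\ infinite_set K] C') :
  is_basis (Inn sigma tau)
    [set inner_der sigma tau (grpring_elt g) |
      g in (\bigcup_(i in ~` J) (C i `\ x i)) `|` (\bigcup_i' C' i')].
Proof.
have [C_fun C_inj C_surj] := C_enum.
have [C'_fun _ C'_surj] := C'_enum.
have C_class i : twisted_classes s t (C i) by have [] := C_fun i Logic.I.
have C_fin i : finite_set (C i) by have [] := C_fun i Logic.I.
have C'_class i : twisted_classes s t (C' i) by have [] := C'_fun i Logic.I.
have C'_inf i : infinite_set (C' i) by have [] := C'_fun i Logic.I.
pose S := (\bigcup_(i in ~` J) (C i `\ x i)) `|` (\bigcup_i' C' i').
pose B := [set inner_der sigma tau (grpring_elt g) | g in S].
rewrite -/S -/B.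
(* Distinct classes are disjoint and each finite class has one index, so no
   representative comes back as a point of another class. *)
have x_notin i : ~ S (x i).
  case=> [[k _ [Ckx /= xik]]|[i' _ C'x]].
    suff ik : i = k by apply: xik; rewrite ik.
    apply: C_inj; rewrite ?in_setE//.
    rewrite (twisted_class_eq (C_class k) Ckx).
    by rewrite -(twisted_class_eq (C_class i) (x_rep i)).
  apply: (C'_inf i'); rewrite (twisted_class_eq (C'_class i') C'x)//.
  by rewrite -(twisted_class_eq (C_class i)).
split=> [n b c b_inj bB sum0|].
  have /choice[g gP] i :
      exists h, S h /\ inner_der sigma tau (grpring_elt h) = b i.
    by have [h Sh <-] := bB i; exists h.
  (* Distinct derivations come from distinct group elements, so each c i is a
     single coefficient of the element beta below. *)
  have g_inj : injective g.
    by move=> i j gij; apply: b_inj; rewrite -(gP i).2 -(gP j).2 gij.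
  pose beta : grpring R G := \sum_(i < n) c i *: grpring_elt (g i).
  have beta_fun : class_function s t beta.
    apply/(inner_der_eq0P sigma_ext tau_ext); rewrite inner_der_sum -[RHS]sum0.
    by apply: eq_bigr => i _; rewrite inner_derZ (gP i).2.
  have beta_coef k : beta@_k = \sum_(i < n) c i * (g i == k)%:R.
    rewrite raddf_sum; apply: eq_bigr => i _.
    by rewrite /= grpring_scaleE mcoeff_elt.
  have beta_g i : beta@_(g i) = c i.
    rewrite beta_coef (bigD1 i)//= eqxx mulr1 big1 ?addr0// => j ji.
    by rewrite (inj_eq g_inj) (negPf ji) mulr0.
  move=> i; rewrite -beta_g.
  have [[[k _ [Ckg _]]|[i' _ C'g]] _] := gP i; last first.
    apply: (class_function_infinite beta_fun).
    by rewrite -(twisted_class_eq (C'_class i') C'g).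
  rewrite (class_function_const (x := x k) beta_fun); last first.
    by rewrite -(twisted_class_eq (C_class k) (x_rep k)).
  rewrite beta_coef big1// => j _; case: eqP; rewrite ?mulr0// => gjx.
  by case: (x_notin k); rewrite -gjx; have [] := gP j.
have span_C i g : C i g -> g != x i ->
    lin_span B (inner_der sigma tau (grpring_elt g)).
  move=> Cg /eqP gx; apply: lin_span_gen; exists g => //; left.
  exists i => // Ji.
  (* A singleton class cannot contain both g and x i. *)
  have /card_set_bijP[f [f_fun f_inj _]] := J_card _ Ji.
  apply: gx; apply: f_inj; rewrite ?in_setE//.
  have := f_fun _ Cg; have := f_fun _ (x_rep i).
  by rewrite /= !ltnS !leqn0 => /eqP -> /eqP ->.
have span_elt g : lin_span B (inner_der sigma tau (grpring_elt g)).
  have gK : twisted_classes s t (twisted_class s t g) by exists g.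
  have [K_fin|K_inf] := pselect (finite_set (twisted_class s t g)); last first.
    have [i' _ C'g] := C'_surj _ (conj gK K_inf).
    apply: lin_span_gen; exists g => //; right; exists i' => //.
    by rewrite C'g; exact: twisted_class_refl.
  have [i _ CiE] := C_surj _ (conj gK K_fin).
  have Cg : C i g by rewrite CiE; exact: twisted_class_refl.
  have [->|] := eqVneq g (x i); last exact: span_C.
  (* The class sum relation, solved for the term of the representative. *)
  have := sum_inner_der_class sigma_ext tau_ext (C_class i) (C_fin i).
  rewrite (big_fsetD1 (x i)) /=; last by rewrite in_fset_set// in_setE.
  move=> /eqP; rewrite addr_eq0 => /eqP ->.
  apply: lin_spanN; apply: lin_span_sum => h + _.
  by rewrite !inE in_fset_set// =>  /andP[hx /set_mem Ch]; exact: (span_C i).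
apply/seteqP; split=> [_ [n [b [c [bB ->]]]]|_ [beta _ <-]].
  have /choice[g gP] i : exists h, inner_der sigma tau (grpring_elt h) = b i.
    by have [h _ <-] := bB i; exists h.
  exists (\sum_(i < n) c i *: grpring_elt (g i)) => //.
  by rewrite inner_der_sum; apply: eq_bigr => i _; rewrite inner_derZ gP.
rewrite inner_der_sum_elt; apply: lin_span_sum => g _ _.
exact: lin_spanZ.
Qed.
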